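(* The peripheral Poisson boundary $(P(P_\omega),\circ)$ strictly contains the Poisson boundary $F(P_\omega)$ as a C*-subalgebra; in particular $F(P_\omega)\subsetneq P(P_\omega)$.
   Context: $H$ is a separable Hilbert space with orthonormal basis $\{e_i: i\in\Theta\}$, where $\Theta=\{1,\dots,n\}$ with $n>1$, or $\Theta=\mathbb{N}$. $\mathcal{F}(H)=\bigoplus_{n\ge 0}H^{\otimes n}$ is the full Fock space, with $H^{\otimes 0}=\mathbb{C}\Omega$, $\Omega$ a unit (vacuum) vector. For $\xi\in H$, $l_\xi$ is the left creation operator on $\mathcal{F}(H)$, $l_\xi(\eta)=\xi\otimes\eta$ (with $l_\xi\Omega=\xi$), and $l_i=l_{e_i}$. $\omega=(\omega_i)_{i\in\Theta}$ is a family of positive reals with $\sum_{i\in\Theta}\omega_i=1$, and $P_\omega:B(\mathcal{F}(H))\to B(\mathcal{F}(H))$ is the normal unital completely positive map $P_\omega(x)=\sum_{i\in\Theta}\omega_i\, l_i^*xl_i$. For $\lambda\in\mathbb{T}$ (unit circle), $E_\lambda(P_\omega)=\{x: P_\omega(x)=\lambda x\}$. The Poisson boundary is $F(P_\omega)=E_1(P_\omega)$, a von Neumann algebra under the Choi–Effros product $x\circ y=\text{SOT-}\lim_{m\to\infty}P_\omega^m(xy)$. The peripheral Poisson boundary $P(P_\omega)$ is the norm-closed linear span in $B(\mathcal F(H))$ of $\bigcup_{\lambda\in\mathbb{T}}E_\lambda(P_\omega)$. It is known (Bhat–Kar–Talwar) that $P(P_\omega)$ is a unital C*-algebra with the operator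 norm, the usual adjoint, unit $1$, and the modified Choi–Effros product $\circ$, the unique norm-continuous bilinear map on $P(P_\omega)$ such that $x\circ y=\text{SOT-}\lim_{m\to\infty}(\lambda\mu)^{-m}P_\omega^m(xy)$ for $x\in E_\lambda(P_\omega)$, $y\in E_\mu(P_\omega)$. *)

(* Defs.v *)
From HB Require Import structures.
From mathcomp Require Import all_boot all_order all_algebra.
From mathcomp Require Import complex.
From mathcomp Require Import all_classical all_reals all_analysis.

Set Implicit Arguments.
Unset Strict Implicit.
Unset Printing Implicit Defensive.

Import Order.TTheory GRing.Theory Num.Theory.
Import numFieldNormedType.Exports.

Local Open Scope classical_set_scope.
Local Open Scope ring_scope.
Local Open Scope complex_scope.

(** A Hilbert space is a complete normed R[i]-module [V] together with an inner
    product [dot : {dot V for conjC}] (linear in the first argument) that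
    induces the norm. *)
Definition induces_norm (R : realType) (V : normedModType R[i])
    (dot : {dot V for Num.Def.conjC}) : Prop :=
  forall u : V, `|u| ^+ 2 = dot u u.

Definition lin_span (K : numFieldType) (V : lmodType K) (S : set V) : set V :=
  [set x | exists n (c : 'I_n -> K) (v : 'I_n -> V),
     (forall k, S (v k)) /\ x = \sum_(k < n) c k *: v k].

(** The values of [e] outside of [I] are irrelevant. *)
Record orthonormal_basis (R : realType) (V : normedModType R[i])
    (dot : {dot V for Num.Def.conjC}) (I : set nat) (e : nat -> V) : Prop := {
  onb_orthonormal : forall i j, I i -> I j -> dot (e i) (e j) = (i == j)%:R;
  onb_total : closure (lin_span (e @` I)) = setT }.

(** [F], with inner product [dotF], is the full Fock space of [H]:
    [tens [:: x1; ...; xn]] is the elementary tensor x1 (x) ... (x) xn, and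
    [tens [::]] is the vacuum vector.  Tensors of different lengths are
    orthogonal (Hilbert direct sum), the inner product of tensors of the same
    length is the product of the inner products (Hilbert tensor powers), and
    the elementary tensors span a dense subspace.  For complete [F], these
    properties determine [F] and [tens] up to a unique unitary. *)
Record full_fock_space (R : realType) (H F : normedModType R[i])
    (dotH : {dot H for Num.Def.conjC}) (dotF : {dot F for Num.Def.conjC})
    (tens : seq H -> F) : Prop := {
  fock_multilinear : forall (s t : seq H) (a : R[i]) (x y : H),
    tens (s ++ (a *: x + y) :: t) =
      a *: tens (s ++ x :: t) + tens (s ++ y :: t);
  fock_dot : forall s t : seq H,
    dotF (tens s) (tens t) =
      if size s == size t then \prod_(p <- zip s t) dotH p.1 p.2 else 0;
  fock_total : closure (lin_span (range tens)) = setT }.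

Section Operators.
Context (R : realType) (F : normedModType R[i]).

(** The set B(F) of bounded operators. *)
Definition bounded_op : set (F -> F) :=
  [set x | linear x /\ exists M : R[i], forall u, `|x u| <= M * `|u| ].

(** The norm of [F] takes its (real) values in [R[i]]. *)
Definition op_norm (x : F -> F) : R :=
  sup [set complex.Re `|x u| | u in [set u : F | `|u| <= 1]].

Definition norm_closure (S : set (F -> F)) : set (F -> F) :=
  [set x | bounded_op x /\
     forall eps : R, 0 < eps -> exists2 y, S y & op_norm (x - y) < eps].

(** Convergence in the strong operator topology. *)
Definition sot_cvg (s : nat -> F -> F) (x : F -> F) : Prop :=
  forall u : F, s m u @[m --> \oo] --> x u.

(** On a Hilbert space every bounded operator has a unique adjoint, so that the
    default value of [xget] is not used on [bounded_op]. *)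
Definition adjoint (dot : {dot F for Num.Def.conjC}) (x : F -> F) : F -> F :=
  xget 0 [set y | bounded_op y /\ forall u v, dot (x u) v = dot u (y v)].

(** [l xi] is the bounded operator eta |-> xi (x) eta. *)
Definition left_creation (H : normedModType R[i]) (tens : seq H -> F)
    (l : H -> F -> F) : Prop :=
  forall xi, bounded_op (l xi) /\ forall s, l xi (tens s) = tens (xi :: s).

Section Map.
Context (dot : {dot F for Num.Def.conjC}) (Theta : set nat) (omega : nat -> R)
  (l : nat -> F -> F).

(** The map x |-> sum_(i in Theta) omega_i l_i^* x l_i.  When [Theta] is finite
    the sequence of partial sums is eventually constant. *)
Definition P_omega (x : F -> F) : F -> F := fun u =>
  limn (fun m => \sum_(0 <= i < m | i \in Theta)
                   (omega i)%:C *: adjoint dot (l i) (x (l i u))).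

Definition eigenspace (lambda : R[i]) : set (F -> F) :=
  [set x | bounded_op x /\ P_omega x = lambda *: x].

Definition poisson_boundary : set (F -> F) := eigenspace 1.

Definition peripheral_boundary : set (F -> F) :=
  norm_closure (lin_span
    [set x | exists2 lambda : R[i], `|lambda| = 1 & eigenspace lambda x]).

(** [circ] is the modified Choi-Effros product; only its values on
    [peripheral_boundary] matter. *)
Record modified_choi_effros (circ : (F -> F) -> (F -> F) -> (F -> F)) : Prop := {
  mce_closed : forall x y, peripheral_boundary x -> peripheral_boundary y ->
    peripheral_boundary (circ x y);
  mce_linearl : forall (a : R[i]) x x' y, peripheral_boundary x ->
    peripheral_boundary x' -> peripheral_boundary y ->
    circ (a *: x + x') y = a *: circ x y + circ x' y;
  mce_linearr : forall (a : R[i]) x y y', peripheral_boundary x ->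
    peripheral_boundary y -> peripheral_boundary y' ->
    circ x (a *: y + y') = a *: circ x y + circ x y';
  mce_continuous : forall x y, peripheral_boundary x -> peripheral_boundary y ->
    forall eps : R, 0 < eps -> exists2 delta : R, 0 < delta &
      forall x' y', peripheral_boundary x' -> peripheral_boundary y' ->
        op_norm (x' - x) < delta -> op_norm (y' - y) < delta ->
        op_norm (circ x' y' - circ x y) < eps;
  mce_limit : forall (lambda mu : R[i]) x y, `|lambda| = 1 -> `|mu| = 1 ->
    eigenspace lambda x -> eigenspace mu y ->
    sot_cvg (fun m => (lambda * mu) ^- m *: iter m P_omega (x \o y))
            (circ x y) }.

(** The product on [poisson_boundary] is the Choi-Effros one. *)
Definition choi_effros_limit (x y z : F -> F) : Prop :=
  sot_cvg (fun m => iter m P_omega (x \o y)) z.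

End Map.

(** [B] is a C*-subalgebra of the C*-algebra of operators [A], with product
    [circ], unit 1, and the usual linear structure, norm and adjoint. *)
Record cstar_subalgebra (dot : {dot F for Num.Def.conjC})
    (circ : (F -> F) -> (F -> F) -> (F -> F)) (B A : set (F -> F)) : Prop := {
  csub_sub : B `<=` A;
  csub_unit : B id;
  csub_linear : forall (a : R[i]) x y, B x -> B y -> B (a *: x + y);
  csub_mul : forall x y, B x -> B y -> B (circ x y);
  csub_adjoint : forall x, B x -> B (adjoint dot x);
  csub_closed : norm_closure B `<=` B }.

End Operators.

(* Main.v *)
Require Import Defs.
From HB Require Import structures.
From mathcomp Require Import all_boot all_order all_algebra.
From mathcomp Require Import complex.
From mathcomp Require Import all_classical all_reals all_analysis.
Import Order.TTheory GRing.Theory Num.Theory.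
Import numFieldNormedType.Exports.
Local Open Scope classical_set_scope.
Local Open Scope ring_scope.
Local Open Scope complex_scope.

Set Implicit Arguments.
Unset Strict Implicit.

(** The gauge unitary U = (-1)^N, where N is the number operator of the Fock
    space, satisfies U l_i = - l_i U, hence P_omega U = - U: a nonzero
    eigenvector for -1 that is not harmonic.

    As the l_i are isometries and the weights sum to 1, P_omega is contractive,
    preserves adjoints and is SOT-continuous on bounded sequences (the tail of
    the weights controls the tail of the series uniformly).  So its fixed points
    form a closed self-adjoint subspace, and the SOT-limit of P_omega^m (xy) is
    again a fixed point. *)

(** * Inner product inequalities and total sets *)

Section HilbertSpace.
Context {R : realType} {V : completeNormedModType R[i]}.
Context {dot : {dot V for Num.Def.conjC}} (hdot : induces_norm dot).

Lemma dotZl a u v : dot (a *: u) v = a * dot u v.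
Proof. by rewrite linearZl_LR. Qed.

Lemma dotZr a u v : dot u (a *: v) = Num.conj a * dot u v.
Proof. by rewrite linearZr_LR. Qed.

Lemma dotDl u v w : dot (u + v) w = dot u w + dot v w.
Proof. exact: linearDl. Qed.

Lemma dotBl u v w : dot (u - v) w = dot u w - dot v w.
Proof. exact: linearBl. Qed.

Lemma dotBr u v w : dot u (v - w) = dot u v - dot u w.
Proof. exact: linearBr. Qed.

Lemma dot_suml I (s : seq I) (P : pred I) (f : I -> V) v :
  dot (\sum_(i <- s | P i) f i) v = \sum_(i <- s | P i) dot (f i) v.
Proof. exact: linear_sumlz. Qed.

Lemma dot_sumr I (s : seq I) (P : pred I) (f : I -> V) v :
  dot v (\sum_(i <- s | P i) f i) = \sum_(i <- s | P i) dot v (f i).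
Proof. exact: linear_sumr. Qed.

Lemma dotC u v : dot u v = Num.conj (dot v u).
Proof. by rewrite hermC mul1r. Qed.

(** Cauchy-Schwarz: [u] splits into a multiple of [v] and a remainder orthogonal to [v], and
    Pythagoras gives the bound. *)
Lemma dot_le u v : `|dot u v| <= `|u| * `|v|.
Proof.
have [->|v0] := eqVneq v 0; first by rewrite linear0r !normr0 mulr0.
rewrite -(@ler_pXn2r _ 2)// ?nnegrE// exprMn !hdot.
set a := dot u v / dot v v.
have ow : dot (u - a *: v) v = 0.
  by rewrite dotBl dotZl divfK ?subrr// dnorm_eq0.
have -> : dot u u = dot (u - a *: v) (u - a *: v) + `|a| ^+ 2 * dot v v.
  rewrite -dnormZ -hnormDd ?subrK//.
  by apply: etrans (dotZr _ _ _) _; rewrite ow mulr0.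
have -> : `|dot u v| ^+ 2 = `|a| ^+ 2 * dot v v * dot v v.
  rewrite -mulrA -expr2 -[X in X ^+ 2 = _](ger0_norm (normr_ge0 _)).
  rewrite -[dot v v in RHS](ger0_norm (dnorm_ge0 _ _)) -exprMn -normrM divfK//.
    by rewrite normr_id.
  by rewrite dnorm_eq0.
by rewrite ler_wpM2r// lerDr.
Qed.

Lemma dot_total_eq0 (S : set V) u :
  closure (lin_span S) = setT -> (forall s, S s -> dot u s = 0) -> u = 0.
Proof.
move=> totS uS; apply/eqP; rewrite -normr_eq0; apply/negPn/negP => u0.
have pu : 0 < `|u| by rewrite lt_def u0 normr_ge0.
have : closure (lin_span S) u by rewrite totS.
move=> /(_ _ (nbhsx_ballx u _ pu))[_ [[n [c [v [Sv ->]]]]]].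
rewrite -ball_normE/= => us.
set w := \sum_(k < n) _ in us.
(* As [u] is orthogonal to [w], Cauchy-Schwarz bounds its squared norm by its norm times the
   distance from [u] to [w]; that distance is below the norm of [u], which is absurd. *)
have : dot u u = dot u (u - w).
  rewrite dotBr [X in _ - X]dot_sumr big1 ?subr0// => k _.
  by rewrite dotZr uS ?mulr0.
move=> uu; have := dot_le u (u - w).
rewrite -uu -hdot ger0_norm ?exprn_ge0// expr2 ler_pM2l//.
by move=> /(lt_le_trans us); rewrite ltxx.
Qed.

End HilbertSpace.

(** * Bounded operators defined by their graph on a total set *)

Section BoundedOperators.
Context {R : realType} {V : completeNormedModType R[i]}.

Lemma dense_approx (S : set V) u (e : R[i]) :
  closure S = setT -> 0 < e -> exists2 s, S s & `|u - s| < e.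
Proof.
move=> dS e0; have : closure S u by rewrite dS.
move=> /(_ _ (nbhsx_ballx u _ e0))[s [Ss]].
by rewrite -ball_normE/=; exists s.
Qed.

(** The bound [M] is any complex number, but its product with the norm of [u] dominates a norm, so
    that product is nonnegative and equals its own modulus. *)
Lemma bounded_opP (x : V -> V) :
  bounded_op x <->
  linear x /\ exists2 M : R[i], 0 <= M & forall u, `|x u| <= M * `|u|.
Proof.
split=> [[lx [M xM]]|[lx [M M0 xM]]]; last by split=> //; exists M.
split=> //; exists `|M| => // u.
by have := le_trans (normr_ge0 _) (xM u) => /ger0_norm; rewrite normrM normr_id => ->.
Qed.

(* [G] is the closed graph of a partially defined bounded linear map. *)
Lemma bounded_graph_ext (G : V -> V -> Prop) (M : R[i]) (S : set V) :
  G 0 0 ->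
  (forall a u v u' v', G u v -> G u' v' -> G (a *: u + u') (a *: v + v')) ->
  (forall u v, G u v -> `|v| <= M * `|u|) ->
  (forall u v, (forall e : R[i], 0 < e ->
     exists u' v', [/\ G u' v', `|u - u'| < e & `|v - v'| < e]) -> G u v) ->
  closure (lin_span S) = setT -> (forall s, S s -> exists v, G s v) ->
  exists x, bounded_op x /\ forall u, G u (x u).
Proof.
move=> G0 GP GM Gcl totS SG.
have GM' u v : G u v -> `|v| <= `|M| * `|u|.
  move=> /GM /[dup] /(le_trans (normr_ge0 v)) /ger0_norm.
  by rewrite normrM normr_id => ->.
have GB u v u' v' : G u v -> G u' v' -> G (u - u') (v - v').
  by move=> h h'; have := GP (-1) _ _ _ _ h' h; rewrite !scaleN1r ![- _ + _]addrC.
have spanG u : lin_span S u -> exists v, G u v.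
  move=> [n [c [w [Sw ->]]]]; pose T w0 := exists v, G w0 v.
  rewrite -/(T _); apply: big_ind => [|w1 w2 [v1 g1] [v2 g2]|k _].
  - by exists 0.
  - by exists (v1 + v2); rewrite -(scale1r v1) -(scale1r w1); exact: GP.
  - have [v g] := SG _ (Sw k); exists (c k *: v + 0).
    by rewrite -[_ *: w k]addr0; exact: GP.
(* Once every [u] has a value, a choice function works: [GM'] at the point 0 makes two values over
   one point equal, whence linearity. *)
suff domG u : exists v, G u v.
  pose x u := xget 0 [set v | G u v].
  have xP u : G u (x u) by exact: xgetPex (domG u).
  exists x; split=> //; split; last by exists M => u; exact: GM.
  move=> a u v; apply/eqP; rewrite -subr_eq0 -normr_le0.
  have := GM' _ _ (GB _ _ _ _ (xP (a *: u + v)) (GP a _ _ _ _ (xP u) (xP v))).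
  by rewrite subrr normr0 mulr0.
(* The image under [G] of the neighbourhood filter of [u]. The bound makes it Cauchy, and closedness
   of the graph makes its limit a value at [u]. *)
pose FF : set_system V := [set Q | \forall s \near u, forall v, G s v -> Q v].
have FFF : ProperFilter FF.
  split; last split.
  - move=> /nbhs_ballP[e /= e0]; rewrite -ball_normE /= => bu.
    by have [s /spanG[v Gv] us] := dense_approx u totS e0; exact: bu Gv.
  - exact: nearW.
  - move=> P Q; apply: (@filterS2 _ (nbhs u)) => s Ps Qs v Gv.
    by split; [exact: Ps|exact: Qs].
  - by move=> P Q PQ; apply: (@filterS _ (nbhs u)) => s Ps v Gv; exact/PQ/Ps.
have M1 : 0 < `|M| + 1 by rewrite ltr_wpDl.
have FFc e : 0 < e -> exists s v, [/\ G s v, `|u - s| < e & FF [set w | `|w - v| < e]].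
  (* Two points within [d] of [u] are less than [d + d] apart, so their values differ by less than
     [e]. The [+ 1] keeps the denominator nonzero. *)
  move=> e0; pose d := e / (`|M| + 1) / 2.
  have d0 : 0 < d by rewrite !divr_gt0.
  have dM : (`|M| + 1) * (d + d) = e.
    by rewrite -splitr mulrC divfK// gt_eqF.
  have de : d < e.
    by rewrite -dM mulrDl mul1r addrA ltrDr ltr_wpDl// mulr_ge0// addr_ge0// ltW.
  have [s Ss us] := dense_approx u totS d0; have [v Gv] := spanG _ Ss.
  exists s; exists v; split=> //; first exact: lt_trans us de.
  suff: \forall s' \near u, forall w, G s' w -> `|w - v| < e by [].
  apply/nbhs_ballP; exists d => //= s'; rewrite -ball_normE/= => us' w Gw.
  apply: le_lt_trans (GM' _ _ (GB _ _ _ _ Gw Gv)) _.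
  rewrite -dM (@le_lt_trans _ _ (`|M| * (d + d)))//; last first.
    by rewrite ltr_pM2r ?addr_gt0// ltrDl.
  rewrite ler_wpM2l// (le_trans (ler_distD u _ _))// distrC.
  by rewrite lerD// ltW.
have : cauchy FF.
  apply: cauchy_exP => e /FFc[s [v [_ _ h]]]; exists v.
  by apply: filterS h => w; rewrite -ball_normE/= distrC.
move=> /cauchy_cvgP /cvg_ex[v FFv]; exists v; apply: Gcl => e e0.
have e20 : 0 < e / 2 by rewrite divr_gt0.
have [s [w [Gsw us h]]] := FFc _ e20; exists s, w; split=> //.
  by rewrite (lt_trans us)// ltr_pdivrMr// ltr_pMr// ltr1n.
have : FF (ball v (e / 2)) by apply: FFv; exact: nbhsx_ballx.
rewrite -ball_normE/= => h'.
have [w' [/= vw' w'w]] := filter_ex (filterI h' h).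
by rewrite (le_lt_trans (ler_distD w' _ _))// (splitr e) ltrD.
Qed.

End BoundedOperators.

Lemma ge0_ReE (R : realType) (z : R[i]) : 0 <= z -> z = (complex.Re z)%:C.
Proof. by case: z => a b; rewrite lecE/= => /andP[/eqP -> _]. Qed.

(** * Vector series with positive weights of total mass 1 *)

Section WeightedSums.
Context {R : realType} {V : completeNormedModType R[i]}.
Variables (Theta : set nat) (omega : nat -> R).
Hypothesis omega_gt0 : forall i, Theta i -> 0 < omega i.
Hypothesis omega_sum : (\sum_(i <oo | i \in Theta) (omega i)%:E = 1)%E.

Definition weight (m : nat) : R := \sum_(0 <= i < m | i \in Theta) omega i.

Definition psum (f : nat -> V) (m : nat) : V :=
  \sum_(0 <= i < m | i \in Theta) (omega i)%:C *: f i.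

Definition wsum (f : nat -> V) : V := limn (psum f).

Lemma weight_le m n : (m <= n)%N -> weight m <= weight n.
Proof.
move=> mn; rewrite /weight (big_cat_nat _ mn)//= lerDl.
by apply: sumr_ge0 => i; rewrite inE => /omega_gt0/ltW.
Qed.

Lemma weight_cvg : weight @ \oo --> (1 : R).
Proof.
have : (EFin \o weight) @ \oo --> 1%:E.
  rewrite -[X in _ --> X]omega_sum.
  rewrite (_ : EFin \o weight =
    fun n => (\sum_(0 <= i < n | i \in Theta) (omega i)%:E)%E); last first.
    by apply/funext => n; rewrite /= sumEFin.
  by apply: is_cvg_nneseries => i _; rewrite inE lee_fin => /omega_gt0/ltW.
by move=> /fine_cvg.
Qed.

Lemma weight_le1 m : weight m <= 1.
Proof.
rewrite -(cvg_lim _ weight_cvg)//.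
by apply: (nondecreasing_cvgn_le weight_le); apply/cvg_ex; exists 1; exact: weight_cvg.
Qed.

Lemma weight_near (C e : R[i]) : 0 <= C -> 0 < e ->
  \forall m \near \oo, (1 - weight m)%:C * C < e.
Proof.
move=> C0 e0.
have C1 : 0 < C + 1 by rewrite ltr_wpDl.
pose d := complex.Re (e / (C + 1)).
have dE : e / (C + 1) = d%:C.
  by rewrite /d -ge0_ReE// ltW// divr_gt0.
have d0 : 0 < d by rewrite -ltcR -dE divr_gt0.
have /cvgrPdist_lt/(_ d d0) := weight_cvg.
apply: filterS => m; rewrite ger0_norm ?subr_ge0 ?weight_le1// => Wd.
apply: (@le_lt_trans _ _ ((1 - weight m)%:C * (C + 1))).
  by rewrite ler_wpM2l ?lerDl// lecR subr_ge0 weight_le1.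
by rewrite -ltr_pdivlMr// dE ltcR.
Qed.

Lemma psum_dist f (C : R[i]) m n : (forall i, Theta i -> `|f i| <= C) ->
  (m <= n)%N -> `|psum f n - psum f m| <= (weight n - weight m)%:C * C.
Proof.
move=> fC mn.
have -> : weight n - weight m = \sum_(m <= i < n | i \in Theta) omega i.
  by rewrite /weight (big_cat_nat _ mn)//= [_ + _ - _]addrAC subrr add0r.
rewrite /psum (big_cat_nat _ mn)//= [_ + _ - _]addrAC subrr add0r.
rewrite (le_trans (ler_norm_sum _ _ _))// rmorph_sum/= mulr_suml.
apply: ler_sum => i; rewrite inE => Ti.
rewrite normrZ ler_pM//; last exact: fC.
by rewrite ger0_norm// lecR ltW// omega_gt0.
Qed.

Lemma psum_cvg f (C : R[i]) : 0 <= C -> (forall i, Theta i -> `|f i| <= C) ->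
  psum f @ \oo --> wsum f.
Proof.
move=> C0 fC.
suff : cvgn (psum f) by [].
apply: cauchy_cvg; apply: cauchy_exP => e e0.
have [m _ hm] := weight_near C0 e0; exists (psum f m).
exists m => // n mn; rewrite -ball_normE/= distrC.
apply: le_lt_trans (psum_dist fC mn) _.
apply: le_lt_trans (hm m (leqnn m)).
by rewrite ler_wpM2r// lecR lerD2r weight_le1.
Qed.

(** The estimate depends on [f] only through the bound [C]. This uniformity lets limits and inner
    products pass through the series. *)
Lemma psum_tail f (C : R[i]) m : 0 <= C -> (forall i, Theta i -> `|f i| <= C) ->
  `|wsum f - psum f m| <= (1 - weight m)%:C * C.
Proof.
move=> C0 fC; apply/ler_addgt0Pl => e e0.
have /cvgrPdist_le/(_ e e0)[n _ hn] := psum_cvg C0 fC.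
have mM := leq_maxl m n.
apply: le_trans (ler_distD (psum f (maxn m n)) _ _) _.
rewrite lerD//; first by apply: hn; exact: leq_maxr.
apply: le_trans (psum_dist fC mM) _.
by rewrite ler_wpM2r// lecR lerD2r weight_le1.
Qed.

Lemma wsum_le f (C : R[i]) : 0 <= C -> (forall i, Theta i -> `|f i| <= C) ->
  `|wsum f| <= C.
Proof.
move=> C0 fC; have := psum_tail 0 C0 fC.
by rewrite /psum /weight !big_nil !subr0 mul1r.
Qed.

Lemma eq_wsum f g : (forall i, Theta i -> f i = g i) -> wsum f = wsum g.
Proof.
move=> fg; rewrite /wsum; suff -> : psum f = psum g by [].
apply/funext => m.
by apply: eq_bigr => i; rewrite inE => /fg ->.
Qed.

Lemma wsum_cst v : wsum (fun=> v) = v.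
Proof.
apply: cvg_lim => //; apply/cvgrPdist_lt => e e0.
have := weight_near (normr_ge0 v) e0; apply: filterS => m.
apply: le_lt_trans; rewrite /psum -scaler_suml -rmorph_sum/= -/(weight m).
rewrite -[X in X - _]scale1r -scalerBl normrZ ger0_norm ?rmorphB//=.
by rewrite -(rmorphB (real_complex R))/= lecR subr_ge0 weight_le1.
Qed.

Lemma wsum_linear (a C D : R[i]) f g : 0 <= C -> 0 <= D ->
  (forall i, Theta i -> `|f i| <= C) -> (forall i, Theta i -> `|g i| <= D) ->
  wsum (fun i => a *: f i + g i) = a *: wsum f + wsum g.
Proof.
move=> C0 D0 fC gD; apply: cvg_lim => //.
rewrite (_ : psum _ = fun m => a *: psum f m + psum g m).
  by apply: cvgD; [apply: cvgZr; exact: psum_cvg fC|exact: psum_cvg gD].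
apply/funext => m; rewrite /psum scaler_sumr -big_split/=; apply: eq_bigr => i _.
by rewrite scalerDr !scalerA mulrC.
Qed.

(** Dominated convergence: at a suitable cut [m] the tails of [f n] and [g] are each below a quarter
    of [e], uniformly in [n], and the finite sum up to [m] converges termwise. *)
Lemma wsum_cvg (f : nat -> nat -> V) g (C : R[i]) : 0 <= C ->
  (forall n i, Theta i -> `|f n i| <= C) ->
  (forall i, Theta i -> f ^~ i @ \oo --> g i) ->
  (fun n => wsum (f n)) @ \oo --> wsum g.
Proof.
move=> C0 fC fg.
have gC i : Theta i -> `|g i| <= C.
  move=> Ti; apply/ler_addgt0Pl => e e0.
  have /cvgrPdist_le/(_ e e0)[n _ /(_ _ (leqnn n)) h] := fg i Ti.
  rewrite -[g i](subrK (f n i)) (le_trans (ler_normD _ _))//.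
  by rewrite lerD// fC.
apply/cvgrPdist_lt => e e0.
have e3 : 0 < e / 2 / 2 by rewrite !divr_gt0.
have [m _ /(_ m (leqnn m)) hm] := weight_near C0 e3.
have : (fun n => psum (f n) m) @ \oo --> psum g m.
  rewrite /psum; apply: cvg_big => [|i]; first exact: add_continuous.
  rewrite inE => Ti.
  by apply: cvgZr; exact: fg.
move=> /cvgrPdist_lt /(_ (e / 2)); rewrite divr_gt0// => /(_ isT).
apply: filterS => n hn.
have h1 := le_lt_trans (psum_tail m C0 gC) hm.
have := le_lt_trans (psum_tail m C0 (fC n)) hm; rewrite distrC => h2.
have := ltrD (ltrD h1 h2) hn; rewrite -!splitr; apply: le_lt_trans.
rewrite addrAC; apply: le_trans (ler_distD (psum (f n) m) _ _) _.
by rewrite lerD// ler_distD.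
Qed.

(** The partial sums satisfy the identity because the weights are real, so only two tails remain,
    and both are small. *)
Lemma dot_wsum (dot : {dot V for Num.Def.conjC}) (C D : R[i]) f g u v :
  induces_norm dot -> 0 <= C -> 0 <= D ->
  (forall i, Theta i -> `|f i| <= C) -> (forall i, Theta i -> `|g i| <= D) ->
  (forall i, Theta i -> dot (f i) u = dot v (g i)) ->
  dot (wsum f) u = dot v (wsum g).
Proof.
move=> hdot C0 D0 fC gD fg; apply/eqP; rewrite -subr_eq0 -normr_le0.
apply/ler_addgt0Pl => e e0; rewrite addr0.
pose B := C * `|u| + D * `|v|.
have B0 : 0 <= B by rewrite addr_ge0 ?mulr_ge0.
have [m _ /(_ m (leqnn m)) hm] := weight_near B0 e0.
apply: le_trans (ltW hm).
have -> : dot (wsum f) u - dot v (wsum g) =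
    dot (wsum f - psum f m) u - dot v (wsum g - psum g m).
  rewrite dotBl dotBr opprB (_ : dot (psum f m) u = dot v (psum g m)).
    by rewrite addrA subrK.
  rewrite dot_suml dot_sumr.
  apply: eq_bigr => i; rewrite inE => Ti; rewrite dotZl dotZr fg//; congr (_ * _).
  by rewrite conj_Creal//= complex_real.
apply: le_trans (ler_normB _ _) _; rewrite mulrDr.
apply: lerD; apply: le_trans (dot_le hdot _ _) _.
  by rewrite mulrA ler_wpM2r// psum_tail.
by rewrite mulrC mulrA ler_wpM2r// psum_tail.
Qed.

End WeightedSums.

(** * Algebra of bounded operators, adjoints and the operator norm *)

Section Adjoint.
Context {R : realType} {V : completeNormedModType R[i]}.

Lemma le0_mul_small (a K : R[i]) :
  0 <= K -> (forall e, 0 < e -> a <= e * K) -> a <= 0.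
Proof.
move=> K0 h; apply/ler_addgt0Pl => e e0; rewrite addr0.
have K1 : 0 < K + 1 by rewrite ltr_wpDl.
apply: le_trans (h (e / (K + 1)) _) _; first by rewrite divr_gt0.
by rewrite -mulrA ler_piMr ?(ltW e0)// mulrC ler_pdivrMr// mul1r lerDl.
Qed.

Lemma linear_subE (x : V -> V) u v : linear x -> x (u - v) = x u - x v.
Proof. by move=> lx; rewrite addrC -scaleN1r lx scaleN1r addrC. Qed.

Lemma linear_op0 (x : V -> V) : linear x -> x 0 = 0.
Proof. by move=> lx; rewrite -{1}(subrr 0) linear_subE// subrr. Qed.

Lemma linear_opZ (x : V -> V) (a : R[i]) u : linear x -> x (a *: u) = a *: x u.
Proof. by move=> lx; rewrite -[a *: u in LHS]addr0 lx linear_op0// addr0. Qed.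

Lemma scaleopE (a : R[i]) (x : V -> V) u : (a *: x) u = a *: x u.
Proof. by []. Qed.

Lemma lincombE (a : R[i]) (x y : V -> V) u : (a *: x + y) u = a *: x u + y u.
Proof. by []. Qed.

Lemma bounded_op_lincomb (a : R[i]) (x y : V -> V) :
  bounded_op x -> bounded_op y -> bounded_op (a *: x + y).
Proof.
move=> [lx [M xM]] [ly [N yN]]; split.
  by move=> b u v; rewrite !lincombE lx ly !scalerDr !scalerA [b * a]mulrC addrACA.
exists (`|a| * M + N) => u; rewrite lincombE; apply: le_trans (ler_normD _ _) _.
by rewrite mulrDl lerD// normrZ -mulrA ler_wpM2l.
Qed.

Lemma bounded_op0 : bounded_op (0 : V -> V).
Proof.
split; first by move=> a u v; rewrite /= scaler0 addr0.
by exists 0 => u; rewrite mul0r normr0.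
Qed.

Lemma bounded_opZ (a : R[i]) (x : V -> V) : bounded_op x -> bounded_op (a *: x).
Proof.
by move=> bx; rewrite -[_ *: x]addr0; exact: bounded_op_lincomb bounded_op0.
Qed.

Lemma bounded_op_comp (x y : V -> V) :
  bounded_op x -> bounded_op y -> bounded_op (x \o y).
Proof.
move=> /bounded_opP[lx [M M0 xM]] /bounded_opP[ly [N N0 yN]].
split; first by move=> a u v /=; rewrite ly lx.
exists (M * N) => u /=; apply: le_trans (xM _) _.
by rewrite -mulrA ler_wpM2l.
Qed.

Lemma bounded_op_id : bounded_op (id : V -> V).
Proof. by split=> //; exists 1 => u; rewrite mul1r. Qed.

Context {dot : {dot V for Num.Def.conjC}}.

Hypothesis hdot : induces_norm dot.

(** The adjoint relation [G] is a closed graph bounded by [M], so [bounded_graph_ext] reduces its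
    solvability to a total set. *)
Lemma adjoint_exists (S : set V) (x : V -> V) : bounded_op x ->
  closure (lin_span S) = setT ->
  (forall s, S s -> exists w, forall v, dot (x v) s = dot v w) ->
  exists y, bounded_op y /\ forall u v, dot (x u) v = dot u (y v).
Proof.
move=> /bounded_opP[lx [M M0 xM]] totS Sx.
pose G u w := forall v, dot (x v) u = dot v w.
have [||||y [by_ Gy]] := @bounded_graph_ext _ _ G M S _ _ _ _ totS Sx.
- by move=> v; rewrite !linear0r.
- move=> a u v u' v' Guv Gu'v' w.
  by rewrite !(linearDr, linearZr_LR)/= -/(dot _ _) [X in _ * X + _]Guv [X in _ + X]Gu'v'.
(* The squared norm of [w] equals [dot (x w) u], which is at most [M] times the norms of [w] and
   [u]; one norm of [w] cancels. *)
- move=> u w Guw; have [->|w0] := eqVneq w 0; first by rewrite normr0 mulr_ge0.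
  rewrite -(@ler_pM2l _ `|w|) ?normr_gt0// -expr2 hdot -Guw.
  rewrite -[leLHS]ger0_norm; last by rewrite Guw dnorm_ge0.
  apply: le_trans (dot_le hdot _ _) _.
  by rewrite mulrA [`|w| * M]mulrC ler_wpM2r.
- move=> u w h v; apply/eqP; rewrite -subr_eq0 -normr_le0.
  apply: (@le0_mul_small _ (M * `|v| + `|v|)); first by rewrite addr_ge0 ?mulr_ge0.
  move=> e e0; have [u' [w' [G' uu' ww']]] := h e e0.
  have -> : dot (x v) u - dot v w = dot (x v) (u - u') - dot v (w - w').
    by rewrite !dotBr G' opprB addrA subrK.
  apply: le_trans (ler_normB _ _) _; rewrite mulrDr.
  apply: lerD; apply: le_trans (dot_le hdot _ _) _; rewrite mulrC.
    by apply: ler_pM => //; exact: ltW.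
  by rewrite ler_wpM2r// ltW.
by exists y; split=> // u v; exact: Gy.
Qed.

Lemma op_norm_le (x : V -> V) u : bounded_op x ->
  `|x u| <= (op_norm x)%:C * `|u|.
Proof.
move=> /bounded_opP[lx [M M0 xM]].
have [->|u0] := eqVneq u 0; first by rewrite linear_op0// !normr0 mulr0.
have pu : 0 < `|u| by rewrite normr_gt0.
have zu : x u = `|u| *: x (`|u|^-1 *: u).
  by rewrite linear_opZ// scalerA divff ?scale1r// gt_eqF.
rewrite {1}zu normrZ normr_id mulrC ler_wpM2r// (ge0_ReE (normr_ge0 _)) lecR.
apply: ub_le_sup; last first.
  exists (`|u|^-1 *: u) => //=.
  by rewrite normrZ normfV normr_id mulVf// gt_eqF.
exists (complex.Re M) => _ [v /= v1 <-].
have : `|x v| <= M by apply: le_trans (xM v) _; rewrite ler_piMr.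
by rewrite lecE => /andP[].
Qed.

End Adjoint.

(** * The Poisson map of a family of isometries and its eigenspaces *)

Section PoissonMap.
Context {R : realType} {V : completeNormedModType R[i]}.
Context {dot : {dot V for Num.Def.conjC}} (hdot : induces_norm dot).
Context {Theta : set nat} {omega : nat -> R} {L : nat -> V -> V}.
Hypothesis omega_gt0 : forall i, Theta i -> 0 < omega i.
Hypothesis omega_sum : (\sum_(i <oo | i \in Theta) (omega i)%:E = 1)%E.
Hypothesis L_linear : forall i, Theta i -> linear (L i).
Hypothesis L_iso : forall i, Theta i -> forall u v, dot (L i u) (L i v) = dot u v.
Hypothesis L_adjoint : forall i, Theta i -> exists y, bounded_op y /\
  forall u v, dot (L i u) v = dot u (y v).

Local Notation P := (P_omega dot Theta omega L).
Local Notation A i := (adjoint dot (L i)).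

Lemma P_omegaE x u : P x u = wsum Theta omega (fun i => A i (x (L i u))).
Proof. by []. Qed.

Lemma isometry_adjointP i : Theta i ->
  bounded_op (A i) /\ forall u v, dot (L i u) v = dot u (A i v).
Proof. by move=> /L_adjoint h; exact: (xgetPex 0 h). Qed.

Lemma isometry_adjoint_linear i : Theta i -> linear (A i).
Proof. by move=> /isometry_adjointP[[]]. Qed.

Lemma isometry_norm i u : Theta i -> `|L i u| = `|u|.
Proof.
move=> Ti; apply/eqP; rewrite -(@eqrXn2 _ 2)//.
by apply/eqP; rewrite !hdot L_iso.
Qed.

Lemma isometry_adjointK i u : Theta i -> A i (L i u) = u.
Proof.
move=> Ti; apply/eqP; rewrite -subr_eq0 -(dnorm_eq0 dot).
by rewrite dotBr -(isometry_adjointP Ti).2 L_iso// -dotBr subrr linear0r.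
Qed.

Lemma isometry_adjoint_norm_le i u : Theta i -> `|A i u| <= `|u|.
Proof.
move=> Ti; have [->|w0] := eqVneq (A i u) 0; first by rewrite normr0.
rewrite -(@ler_pM2l _ `|A i u|) ?normr_gt0// -expr2 hdot.
rewrite -[leLHS]ger0_norm ?dnorm_ge0// -(isometry_adjointP Ti).2.
by apply: le_trans (dot_le hdot _ _) _; rewrite isometry_norm.
Qed.

Lemma compression_norm_le x (M : R[i]) u : (forall u, `|x u| <= M * `|u|) ->
  forall i, Theta i -> `|A i (x (L i u))| <= M * `|u|.
Proof.
move=> xM i Ti; apply: le_trans (isometry_adjoint_norm_le _ Ti) _.
by rewrite -(isometry_norm u Ti).
Qed.

Lemma P_omega_norm_le x (M : R[i]) u : 0 <= M -> (forall u, `|x u| <= M * `|u|) ->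
  `|P x u| <= M * `|u|.
Proof.
move=> M0 xM; rewrite P_omegaE.
by apply: (wsum_le omega_gt0 omega_sum); [rewrite mulr_ge0|exact: compression_norm_le].
Qed.

Lemma P_omega_lincomb (a : R[i]) x y : bounded_op x -> bounded_op y ->
  P (a *: x + y) = a *: P x + P y.
Proof.
move=> /bounded_opP[lx [M M0 xM]] /bounded_opP[ly [N N0 yN]].
apply/funext => u; rewrite [RHS]lincombE !P_omegaE.
rewrite -(@wsum_linear _ _ _ _ omega_gt0 omega_sum a (M * `|u|) (N * `|u|)) ?mulr_ge0//;
  try exact: compression_norm_le.
by apply: eq_wsum => i Ti; rewrite lincombE isometry_adjoint_linear.
Qed.

(** Each compression of [x] is [c *: x], as [A i] is a left inverse of [L i], and the weights sum to
    1. The case [c = 1] serves [id] and 0, the case [c = -1] the gauge unitary. *)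
Lemma P_omega_intertwiner (c : R[i]) x :
  (forall i u, Theta i -> x (L i u) = c *: L i (x u)) -> P x = c *: x.
Proof.
move=> xL; apply/funext => u; rewrite P_omegaE -[RHS](wsum_cst omega_gt0 omega_sum).
apply: eq_wsum => i Ti; rewrite xL// linear_opZ ?isometry_adjointK//.
exact: isometry_adjoint_linear.
Qed.

Lemma P_omega_sot (s : nat -> V -> V) z (M : R[i]) : 0 <= M ->
  (forall n u, `|s n u| <= M * `|u|) -> sot_cvg s z -> sot_cvg (fun n => P (s n)) (P z).
Proof.
move=> M0 sM sz u; rewrite P_omegaE.
apply: (@wsum_cvg _ _ _ _ omega_gt0 omega_sum _ _ (M * `|u|)).
- by rewrite mulr_ge0.
- by move=> n; exact: compression_norm_le.
- move=> i Ti; apply/cvgrPdist_lt => e e0.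
  have /cvgrPdist_lt/(_ e e0) := sz (L i u); apply: filterS => n.
  apply: le_lt_trans; rewrite -linear_subE; last exact: isometry_adjoint_linear.
  exact: isometry_adjoint_norm_le.
Qed.

(** Compressing by an isometry preserves adjoint pairs, and [dot_wsum] carries this through the
    series. *)
Lemma P_omega_dot x y : bounded_op x -> bounded_op y ->
  (forall u v, dot (x u) v = dot u (y v)) ->
  forall u v, dot (P x u) v = dot u (P y v).
Proof.
move=> /bounded_opP[lx [M M0 xM]] /bounded_opP[ly [N N0 yN]] xy u v.
rewrite !P_omegaE.
apply: (@dot_wsum _ _ _ _ omega_gt0 omega_sum _ (M * `|u|) (N * `|v|)) => //.
- by rewrite mulr_ge0.
- by rewrite mulr_ge0.
- exact: compression_norm_le.
- exact: compression_norm_le.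
- move=> i Ti; rewrite -(isometry_adjointP Ti).2 -xy.
  by rewrite dotC -(isometry_adjointP Ti).2 -dotC.
Qed.

Local Notation FP := (poisson_boundary dot Theta omega L).
Local Notation E := (Defs.eigenspace dot Theta omega L).

Lemma eigenspace_peripheral c :
  `|c| = 1 -> E c `<=` peripheral_boundary dot Theta omega L.
Proof.
move=> c1 x Ex; split; first exact: Ex.1.
move=> e e0; exists x; last first.
  (* [x] approximates itself; the norm of 0 is the supremum of the singleton of 0, attained at the
     vector 0. *)
  rewrite subrr /op_norm (_ : [set _ | _ in _] = [set 0]) ?sup1//.
  apply/seteqP; split=> [_ [u _ <-]|_ ->] /=; first by rewrite /= normr0.
  by exists 0 => /=; rewrite normr0.
exists 1, (fun=> 1), (fun=> x); split; first by move=> _; exists c.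
by rewrite big_ord1 scale1r.
Qed.

Lemma eigenspace_lincomb c a x y : E c x -> E c y -> E c (a *: x + y).
Proof.
move=> [bx Px] [by_ Py]; split; first exact: bounded_op_lincomb.
by rewrite P_omega_lincomb// Px Py scalerDr !scalerA mulrC.
Qed.

(** For [y] in the eigenspace, the defect of [x] is that of [x - y], which contractivity bounds by
    [1 + |c|] times the distance. *)
Lemma norm_closure_eigenspace c : norm_closure (E c) `<=` E c.
Proof.
move=> x [bx xE]; split=> //; apply/funext => u; apply/eqP.
rewrite -subr_eq0 -normr_le0; apply: (@le0_mul_small _ _ ((1 + `|c|) * `|u|)).
  by rewrite mulr_ge0// addr_ge0.
move=> e e0; have eE := ge0_ReE (ltW e0).
have [|y [by_ Py] xy] := xE (complex.Re e); first by rewrite -ltcR -eE.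
have xyE : x - y = -1 *: y + x by rewrite scaleN1r addrC.
have -> : P x u - (c *: x) u = P (x - y) u - c *: (x - y) u.
  rewrite xyE P_omega_lincomb// Py !lincombE !scaleN1r scalerDr scalerN.
  by rewrite opprD opprK addrACA [- _ + _]addrC subrr add0r.
have bxy : bounded_op (x - y).
  by rewrite xyE; exact: bounded_op_lincomb.
have xyM v : `|(x - y) v| <= e * `|v|.
  apply: le_trans (op_norm_le _ bxy) _.
  by rewrite ler_wpM2r// eE lecR ltW.
apply: le_trans (ler_normB _ _) _; rewrite mulrDl mul1r mulrDr.
apply: lerD; first by apply: P_omega_norm_le => //; exact: ltW.
by rewrite normrZ mulrCA ler_wpM2l.
Qed.

(* If [x] had no adjoint, [adjoint dot x] would be the default value 0, which is
   harmonic too: this makes the Riesz representation theorem unnecessary. *)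
Lemma poisson_adjoint x : FP x -> FP (adjoint dot x).
Proof.
move=> [bx Px]; rewrite /adjoint; case: xgetP => [y _ [by_ xy]|_].
  split=> //; rewrite scale1r; apply/funext => v; apply/eqP.
  rewrite -subr_eq0 -(dnorm_eq0 dot) dotBr -(P_omega_dot bx by_ xy) Px scale1r.
  by rewrite xy subrr.
split; first exact: bounded_op0.
apply: P_omega_intertwiner => i u Ti.
by rewrite scale1r linear_op0//; exact: L_linear.
Qed.

Lemma poisson_id : FP id.
Proof.
by split; [exact: bounded_op_id|apply: P_omega_intertwiner => i u _; rewrite scale1r].
Qed.

(** The iterates are uniformly bounded, so applying [P] to them gives a sequence tending to [P z];
    it is also the shifted sequence, which tends to [z]. *)
Lemma poisson_sot_limit x y z : FP x -> FP y -> bounded_op z ->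
  choi_effros_limit dot Theta omega L x y z -> FP z.
Proof.
move=> [bx _] [by_ _] bz xyz; split=> //; rewrite scale1r; apply/funext => u.
have /bounded_opP[_ [M M0 xyM]] := bounded_op_comp bx by_.
have itM n v : `|iter n P (x \o y) v| <= M * `|v|.
  by elim: n v => [|n IHn] v; [exact: xyM|exact: P_omega_norm_le].
have h : P (iter n P (x \o y)) u @[n --> \oo] --> P z u.
  by move: u; exact: P_omega_sot M0 itM xyz.
have h' : iter n.+1 P (x \o y) u @[n --> \oo] --> z u.
  by have := xyz u; rewrite -(cvg_shiftS (fun n => iter n P (x \o y) u)).
exact: cvg_unique h h'.
Qed.

End PoissonMap.

(** * Identities between bounded operators checked on a total set *)

Section TotalSets.
Context {R : realType} {V : completeNormedModType R[i]}.
Context {dot : {dot V for Num.Def.conjC}} (hdot : induces_norm dot).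

(** Allowing distinct vectors [a] and [b] covers adjoint and isometry relations, where [y] is the
    identity. *)
Lemma dot_total_eq (S : set V) (x y : V -> V) a b u :
  bounded_op x -> bounded_op y -> closure (lin_span S) = setT ->
  (forall s, S s -> dot (x s) a = dot (y s) b) -> dot (x u) a = dot (y u) b.
Proof.
move=> /bounded_opP[lx [M M0 xM]] /bounded_opP[ly [N N0 yN]] totS xyS.
have xy s : lin_span S s -> dot (x s) a = dot (y s) b.
  move=> [n [c [v [Sv ->]]]]; apply: (big_ind (fun s => dot (x s) a = dot (y s) b)).
  - by rewrite !linear_op0// !linear0l.
  - by move=> w1 w2 xs xt; rewrite -(scale1r w1) lx ly !dotDl !dotZl xs xt.
  - by move=> k _; rewrite !linear_opZ// !dotZl xyS.
apply/eqP; rewrite -subr_eq0 -normr_le0.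
apply: (@le0_mul_small _ _ (M * `|a| + N * `|b|)).
  by rewrite addr_ge0// mulr_ge0.
move=> e e0; have [s Ss us] := dense_approx u totS e0.
have -> : dot (x u) a - dot (y u) b = dot (x (u - s)) a - dot (y (u - s)) b.
  by rewrite !linear_subE// !dotBl (xy s)// opprB addrA subrK.
apply: le_trans (ler_normB _ _) _; rewrite mulrDr.
have bnd z (K : R[i]) c : 0 <= K -> (forall u, `|z u| <= K * `|u|) ->
    `|dot (z (u - s)) c| <= e * (K * `|c|).
  move=> K0 zK; apply: le_trans (dot_le hdot _ _) _.
  rewrite mulrA ler_wpM2r// (le_trans (zK _))// mulrC ler_wpM2r//; exact: ltW.
by apply: lerD; exact: bnd.
Qed.

Lemma bounded_op_total_eq (S : set V) (x y : V -> V) :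
  bounded_op x -> bounded_op y -> closure (lin_span S) = setT ->
  (forall s, S s -> x s = y s) -> x = y.
Proof.
move=> bx by_ totS xyS; apply/funext => u; apply/eqP.
rewrite -subr_eq0 -(dnorm_eq0 dot) dotBl subr_eq0; apply/eqP.
by apply: dot_total_eq totS _ => // s /xyS ->.
Qed.

End TotalSets.

(** * Creation operators and the gauge unitary on the Fock space *)

Section FockSpace.
Context {R : realType} {H F : completeNormedModType R[i]}.
Context {dotH : {dot H for Num.Def.conjC}} {dotF : {dot F for Num.Def.conjC}}.
Context (hF : induces_norm dotF) {tens : seq H -> F}.
Hypothesis htens : full_fock_space dotH dotF tens.
Context {l : H -> F -> F} (hl : left_creation tens l).

Let totF := fock_total htens.

Lemma creation_iso x : dotH x x = 1 ->
  forall u v, dotF (l x u) (l x v) = dotF u v.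
Proof.
move=> xx; have [bl lE] := hl x.
(* Density is used one argument at a time: first on the left against an elementary tensor, then on
   the right after conjugation. *)
have H1 u s : dotF (l x u) (l x (tens s)) = dotF u (tens s).
  apply: (dot_total_eq hF (y := id) _ bl bounded_op_id totF) => _ [t _ <-].
  rewrite !lE !(fock_dot htens)/= eqSS; case: ifP => // _.
  by rewrite big_cons/= xx mul1r.
move=> u v; apply: (dot_total_eq hF (y := id) _ bl bounded_op_id totF) => _ [t _ <-].
by rewrite dotC H1 -dotC.
Qed.

Lemma creation_adjoint x : exists y, bounded_op y /\
  forall u v, dotF (l x u) v = dotF u (y v).
Proof.
have [bl lE] := hl x; apply: (adjoint_exists hF bl totF) => _ [[|y s] _ <-].
  (* The adjoint annihilates: it kills the vacuum and, in the other case, strips the first factor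
     [y] with coefficient [dotH y x]. *)
  exists 0 => v.
  apply: (dot_total_eq hF (y := id) _ bl bounded_op_id totF) => _ [t _ <-].
  by rewrite lE (fock_dot htens) linear0r.
exists (dotH y x *: tens s) => v.
apply: (dot_total_eq hF (y := id) _ bl bounded_op_id totF) => _ [t _ <-].
rewrite lE dotZr -dotC !(fock_dot htens)/= eqSS; case: ifP => _.
  by rewrite big_cons.
by rewrite mulr0.
Qed.

(** Elementary tensors are linearly dependent, so the sign rule cannot simply be imposed on them. It
    is stated weakly, through inner products with tensors, as a closed graph to which
    [bounded_graph_ext] applies. *)
Lemma fock_parity : exists U, bounded_op U /\
  forall s, U (tens s) = (-1) ^+ size s *: tens s.
Proof.
pose G u v := forall s, dotF v (tens s) = (-1) ^+ size s * dotF u (tens s).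
have sgC n : Num.conj ((-1) ^+ n : R[i]) = (-1) ^+ n.
  by rewrite rmorphXn rmorphN1.
have GM u v : G u v -> `|v| <= 1 * `|u|.
  move=> Guv; rewrite mul1r.
  (* The sign moves from [v] onto the tensors of [w], giving [w']; flipping signs by length
     preserves the norm. *)
  have span w : lin_span (range tens) w -> `|dotF v w| <= `|u| * `|w|.
    move=> [n [c [t [St ->]]]].
    have /choice[s st] k : exists r, tens r = t k.
      by have [r _ <-] := St k; exists r.
    pose w' := \sum_(k < n) c k *: ((-1) ^+ size (s k) *: tens (s k)).
    have -> : dotF v (\sum_(k < n) c k *: t k) = dotF u w'.
      rewrite !dot_sumr; apply: eq_bigr => k _.
      by rewrite !dotZr sgC -st Guv.
    suff <- : `|w'| = `|\sum_(k < n) c k *: t k| by exact: dot_le.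
    apply/eqP; rewrite -(@eqrXn2 _ 2)//; apply/eqP.
    rewrite !hF !dot_suml; apply: eq_bigr => k _.
    rewrite !dot_sumr; apply: eq_bigr => j _.
    (* Tensors of different lengths are orthogonal; for equal lengths the two signs multiply to
       1. *)
    rewrite !dotZl !dotZr sgC -!st (fock_dot htens); case: eqP => [->|_].
      congr (_ * _); rewrite mulrCA; congr (_ * _).
      by rewrite mulrA -expr2 sqrr_sign mul1r.
    by rewrite !mulr0.
  have [->|v0] := eqVneq v 0; first by rewrite normr0.
  rewrite -(@ler_pM2l _ `|v|) ?normr_gt0// -subr_le0.
  apply: (@le0_mul_small _ _ (`|v| + `|u|)); first by rewrite addr_ge0.
  move=> e e0; have [w sw vw] := dense_approx v totF e0.
  (* With [w] within [e] of [v], the first term is at most [e] times the norm of [v], and [span]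
     bounds the second. *)
  have -> : `|v| * `|v| = `|dotF v (v - w) + dotF v w|.
    by rewrite -expr2 -[LHS]ger0_norm ?exprn_ge0// hF -linearDr subrK.
  rewrite lerBlDr; apply: le_trans (ler_normD _ _) _.
  apply: le_trans (lerD (dot_le hF _ _) (span _ sw)) _.
  have wE : `|w| <= `|v| + e.
    by rewrite -lerBlDl (le_trans (lerB_dist _ _))// distrC ltW.
  have vvw := ler_wpM2l (normr_ge0 v) (ltW vw).
  apply: le_trans (lerD vvw (ler_wpM2l (normr_ge0 u) wE)) _.
  rewrite mulrDr mulrDr [e * `|v|]mulrC [e * `|u|]mulrC [`|u| * `|v|]mulrC.
  by rewrite addrCA addrC.
have [||||U [bU UE]] := @bounded_graph_ext _ _ G 1 _ _ _ GM _ totF.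
- by move=> s; rewrite !linear0l mulr0.
- move=> a u v u' v' g g' s; rewrite !dotDl !dotZl g g' mulrDr.
  by rewrite mulrCA.
- move=> u v h s; apply/eqP; rewrite -subr_eq0 -normr_le0.
  apply: (@le0_mul_small _ _ (`|tens s| + `|tens s|)); first by rewrite addr_ge0.
  move=> e e0; have [u' [v' [G' uu' vv']]] := h e e0.
  have -> : dotF v (tens s) - (-1) ^+ size s * dotF u (tens s) =
     dotF (v - v') (tens s) - (-1) ^+ size s * dotF (u - u') (tens s).
    by rewrite !dotBl G' mulrBr opprB addrA subrK.
  apply: le_trans (ler_normB _ _) _; rewrite mulrDr.
  rewrite normrM normrX normrN1 expr1n mul1r.
  by apply: lerD; apply: le_trans (dot_le hF _ _) _; rewrite ler_wpM2r// ltW.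
- move=> _ [s _ <-]; exists ((-1) ^+ size s *: tens s) => t.
  rewrite dotZl (fock_dot htens); case: eqP => [->//|_]; by rewrite !mulr0.
(* [UE] only gives inner products with tensors; totality turns them into an equality of vectors. *)
exists U; split=> // s; apply/eqP; rewrite -subr_eq0; apply/eqP.
apply: (dot_total_eq0 hF totF) => _ [t _ <-].
rewrite dotBl dotZl UE (fock_dot htens); case: eqP => [->|_]; first by rewrite subrr.
by rewrite !mulr0 subrr.
Qed.

End FockSpace.

(** * Strictness of the inclusion and the subalgebra structure *)

Unset Implicit Arguments.
Set Strict Implicit.

Theorem mainTheorem6 (R : realType)
  (* the index set, {0, ..., n-1} with n > 1, or nat *)
  (Theta : set nat)
  (hTheta : (exists2 n : nat, (1 < n)%N & Theta = `I_n) \/ Theta = setT)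
  (* the Hilbert space H and its orthonormal basis *)
  (H : completeNormedModType R[i]) (dotH : {dot H for Num.Def.conjC})
  (hH : induces_norm dotH)
  (e : nat -> H) (he : orthonormal_basis dotH Theta e)
  (* the full Fock space F(H) and its left creation operators *)
  (F : completeNormedModType R[i]) (dotF : {dot F for Num.Def.conjC})
  (hF : induces_norm dotF)
  (tens : seq H -> F) (htens : full_fock_space dotH dotF tens)
  (l : H -> F -> F) (hl : left_creation tens l)
  (* the weights *)
  (omega : nat -> R) (omega_gt0 : forall i, Theta i -> 0 < omega i)
  (omega_sum : (\sum_(i <oo | i \in Theta) (omega i)%:E = 1)%E) :
  let li := fun i : nat => l (e i) in
  let FP := poisson_boundary dotF Theta omega li in
  let PP := peripheral_boundary dotF Theta omega li in
  FP `<` PP /\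
  forall circ : (F -> F) -> (F -> F) -> (F -> F),
    modified_choi_effros dotF Theta omega li circ ->
    cstar_subalgebra dotF circ FP PP /\
    (forall x y, FP x -> FP y ->
       choi_effros_limit dotF Theta omega li x y (circ x y)).
Proof.
move=> li FP PP.
have unit_e i : Theta i -> dotH (e i) (e i) = 1.
  by move=> Ti; rewrite (onb_orthonormal he)// eqxx.
have l_lin i : Theta i -> linear (li i) by move=> _; have [[]] := hl (e i).
have l_iso i : Theta i -> forall u v, dotF (li i u) (li i v) = dotF u v.
  by move=> /unit_e; exact: (creation_iso hF htens hl).
have l_adj i : Theta i -> exists y, bounded_op y /\
    forall u v, dotF (li i u) v = dotF u (y v).
  by move=> _; exact: (creation_adjoint hF htens hl).
have FPsub : FP `<=` PP.
  exact: (eigenspace_peripheral (normr1 _)).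
split.
  split=> // PPsub.
  have [U [bU UE]] := fock_parity hF htens.
  have EU : Defs.eigenspace dotF Theta omega li (-1) U.
    split=> //; apply: (P_omega_intertwiner omega_gt0 omega_sum) => // i u Ti.
    (* Both sides are bounded, so elementary tensors suffice; there [li i] adds one factor, hence
       one sign. *)
    suff /(congr1 (@^~ u)) : U \o li i = -1 *: (li i \o U) by [].
    have [bl lE] := hl (e i).
    apply: (bounded_op_total_eq hF _ _ (fock_total htens)).
    - exact: bounded_op_comp.
    - exact/bounded_opZ/bounded_op_comp.
    - move=> _ [s _ <-]; rewrite scaleopE /li /= lE !UE.
      by rewrite linear_opZ ?lE ?scalerA ?exprS//; exact: (l_lin i Ti).
  have [_] : FP U.
    by apply/PPsub/(eigenspace_peripheral _ EU); rewrite normrN1.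
  (* At the vacuum, which [U] fixes, harmonicity would make the vacuum equal to its opposite,
     although its norm is 1. *)
  rewrite EU.2 => /(congr1 (@^~ (tens [::]))).
  rewrite !scaleopE UE/= expr0 !scale1r scaleN1r => /eqP.
  rewrite -subr_eq0 -opprD oppr_eq0 -mulr2n -scaler_nat scaler_eq0 pnatr_eq0/=.
  rewrite -(dnorm_eq0 dotF) (fock_dot htens)/= big_nil oner_eq0//.
move=> circ hcirc.
(* For both eigenvalues equal to 1 the normalising factor in [mce_limit] is 1. *)
have choi x y : FP x -> FP y -> choi_effros_limit dotF Theta omega li x y (circ x y).
  move=> Fx Fy; have := mce_limit hcirc (normr1 _) (normr1 _) Fx Fy.
  rewrite /choi_effros_limit; congr (sot_cvg _ _); apply/funext => m.
  by rewrite mulr1 expr1n invr1 scale1r.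
split=> //; split => //.
- exact: poisson_id.
- by move=> a x y; exact: eigenspace_lincomb.
- move=> x y Fx Fy.
  apply: (poisson_sot_limit hF omega_gt0 omega_sum l_iso l_adj Fx Fy) (choi x y Fx Fy).
  (* Boundedness of the product: the peripheral boundary consists of bounded operators. *)
  by have [] := mce_closed hcirc (FPsub _ Fx) (FPsub _ Fy).
- exact: poisson_adjoint.
- exact: norm_closure_eigenspace.
Qed.
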